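(* Let $\mathbb K$ be a field of characteristic zero and let $\mathbf E$ be an $n$-dimensional evolution algebra over $\mathbb K$ with structural matrix $A=(a_{ij})_{i,j=1}^n$ in a natural basis $B=\{\mathbf e_i\}_{i=1}^n$. Put $$\gamma:=\sup_{1\le j\le n}\Big\{\sum_{i=1}^n|a_{ij}|\Big\},\qquad \|\mathbf x\|_\gamma:=\gamma\max_{1\le i\le n}\{|x_i|\}\quad\text{for }\mathbf x=\sum_{i=1}^n x_i\mathbf e_i .$$ Then the pair $(\mathbf E,\|\cdot\|_\gamma)$ is a Banach algebra.
   Context: An evolution algebra over a field $\mathbb K$ with respect to a natural basis $\{\mathbf e_1,\dots,\mathbf e_n\}$ is a $\mathbb K$-vector space $\mathbf E$ with this basis and a bilinear (not necessarily associative) multiplication such that $\mathbf e_i\mathbf e_j=\mathbf 0$ for $i\ne j$ and $\mathbf e_i\mathbf e_i=\sum_{k=1}^n a_{ik}\mathbf e_k$; the matrix $A=(a_{ij})$ is the structural matrix in this basis. Here $|\cdot|$ denotes the absolute value on $\mathbb K$. An evolution algebra $\mathbf E$ endowed with a norm $\|\cdot\|$ is a norm algebra if $\|\mathbf a\mathbf b\|\le\|\mathbf a\|\,\|\mathbf b\|$ for all $\mathbf a,\mathbf b\in\mathbf E$, and it is a Banach algebra if this algebra norm is complete.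
   Formalization: The field is assumed complete for its absolute value (false for the rationals with A = (1)), and the structural matrix A is assumed nonzero (for A = 0, γ = 0 and the norm vanishes identically). *)

(* Defs.v *)
From HB Require Import structures.
From mathcomp Require Import all_boot all_order all_algebra.
From mathcomp Require Import all_classical all_reals all_analysis.

Set Implicit Arguments.
Unset Strict Implicit.
Unset Printing Implicit Defensive.

Import Order.TTheory GRing.Theory Num.Theory.
Import numFieldNormedType.Exports.

Local Open Scope classical_set_scope.
Local Open Scope ring_scope.

(* The scalar field carries a real-valued absolute value, archimedean or not.
   The normed structures of the library take their norm in the scalar field
   itself, which would exclude fields such as the p-adic numbers; absolute
   values and norms are therefore plain functions into R here. *)
Definition is_absolute_value (R : realType) (K : fieldType) (abs : K -> R) :
    Prop :=
  [/\ forall x, 0 <= abs x,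
      forall x, abs x = 0 <-> x = 0,
      forall x y, abs (x * y) = abs x * abs y
    & forall x y, abs (x + y) <= abs x + abs y].

Definition is_norm (R : realType) (K : fieldType) (abs : K -> R)
    (E : lmodType K) (N : E -> R) : Prop :=
  [/\ forall x, 0 <= N x,
      forall x, N x = 0 <-> x = 0,
      forall (c : K) x, N (c *: x) = abs c * N x
    & forall x y, N (x + y) <= N x + N y].

Definition cauchy_for (R : realType) (V : zmodType) (N : V -> R)
    (u : nat -> V) : Prop :=
  forall eps : R, 0 < eps ->
    exists M : nat, forall p q : nat,
      (M <= p)%N -> (M <= q)%N -> N (u p - u q) < eps.

Definition complete_for (R : realType) (V : zmodType) (N : V -> R) : Prop :=
  forall u : nat -> V, cauchy_for N u ->
    exists l : V, (fun p => N (u p - l)) @ \oo --> (0 : R).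

(* The multiplication is only bilinear: no associativity is assumed. *)
Definition is_norm_algebra (R : realType) (K : fieldType) (abs : K -> R)
    (E : lmodType K) (mul : {bilinear E -> E -> E}) (N : E -> R) : Prop :=
  is_norm abs N /\ forall a b, N (mul a b) <= N a * N b.

Definition is_banach_algebra (R : realType) (K : fieldType) (abs : K -> R)
    (E : lmodType K) (mul : {bilinear E -> E -> E}) (N : E -> R) : Prop :=
  is_norm_algebra abs mul N /\ complete_for N.

Definition is_evolution_algebra (K : fieldType) (n : nat) (E : vectType K)
    (mul : {bilinear E -> E -> E}) (e : n.-tuple E) (A : 'M[K]_n) : Prop :=
  [/\ basis_of {:E} e,
      forall i j : 'I_n, i != j -> mul (tnth e i) (tnth e j) = 0
    & forall i : 'I_n,
        mul (tnth e i) (tnth e i) = \sum_(k < n) A i k *: tnth e k].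

Definition evo_gamma (R : realType) (K : fieldType) (abs : K -> R) (n : nat)
    (A : 'M[K]_n) : R :=
  sup [set \sum_(i < n) abs (A i j) | j in [set: 'I_n]].

Definition gamma_norm (R : realType) (K : fieldType) (abs : K -> R) (n : nat)
    (E : vectType K) (e : n.-tuple E) (A : 'M[K]_n) (x : E) : R :=
  evo_gamma abs A * \big[Num.max/0]_(i < n) abs (coord e i x).

(* Main.v *)
Require Import Defs.
From HB Require Import structures.
From mathcomp Require Import all_boot all_order all_algebra.
From mathcomp Require Import all_classical all_reals all_analysis.

Set Implicit Arguments.
Unset Strict Implicit.
Unset Printing Implicit Defensive.

Import Order.TTheory GRing.Theory Num.Theory.
Import numFieldNormedType.Exports.

Local Open Scope classical_set_scope.
Local Open Scope ring_scope.

(** In the natural basis the product is a pointwise product followed by the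
    structural matrix: the k-th coordinate of [a b] is the sum over i of
    [a_i b_i A_ik].  By the triangle inequality its absolute value is at most
    the k-th column sum of the [|A_ik|] times [max |a_i| * max |b_i|], hence at
    most [gamma * max |a_i| * max |b_i|] ([coord_max_mul]).  Multiplying by
    [gamma] turns this into submultiplicativity of [gamma * max |x_i|].

    The rest does not involve the product.  The largest coordinate is a norm
    ([coord_max_norm]), and it is complete because a sequence that is Cauchy
    for it is Cauchy in each of its finitely many coordinates, so that
    completeness of the scalars provides a limit coordinate by coordinate
    ([coord_max_complete]).  Both properties survive multiplication by a
    positive constant, and [gamma] is positive as soon as some entry of [A] is
    nonzero ([evo_gamma_gt0]). *)

Section AbsoluteValue.
Context (R : realType) (K : fieldType) (abs : K -> R).
Hypothesis absK : is_absolute_value abs.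

Lemma absolute_value0 : abs 0 = 0.
Proof. by case: absK => _ abs0 _ _; apply/abs0. Qed.

Lemma absolute_value_sum (I : finType) (F : I -> K) :
  abs (\sum_i F i) <= \sum_i abs (F i).
Proof.
case: absK => _ _ _ absD.
elim/big_ind2: _ => [|x a y b xa yb|//]; first by rewrite absolute_value0.
by rewrite (le_trans (absD _ _)) ?lerD.
Qed.

End AbsoluteValue.

Section ScaledNorm.
Context (R : realType) (K : fieldType) (abs : K -> R).

Lemma is_norm_scaled (E : lmodType K) (N : E -> R) (c : R) :
  0 < c -> is_norm abs N -> is_norm abs (fun x => c * N x).
Proof.
move=> c0 [N_ge0 N0 NZ ND]; split=> [x|x|k x|x y].
- by rewrite mulr_ge0 // ltW.
- split=> [/eqP|x0]; last by rewrite (N0 x).2 ?mulr0.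
  by rewrite mulf_eq0 gt_eqF //= => /eqP /N0.
- by rewrite NZ mulrCA.
- by rewrite -mulrDr ler_pM2l.
Qed.

Lemma complete_for_scaled (V : zmodType) (N : V -> R) (c : R) :
  0 < c -> complete_for N -> complete_for (fun x => c * N x).
Proof.
move=> c0 complN u cauchy_u.
have [eps eps0|l ul] := complN u.
  have [M uM] := cauchy_u _ (mulr_gt0 c0 eps0).
  by exists M => p q Mp Mq; have := uM _ _ Mp Mq; rewrite ltr_pM2l.
exists l; rewrite -(mulr0 c); exact: cvgMl_tmp.
Qed.

End ScaledNorm.

Section CoordMax.
Context (R : realType) (K : fieldType) (abs : K -> R) (n : nat).
Context (E : vectType K) (e : n.-tuple E).
Hypothesis absK : is_absolute_value abs.

Definition coord_max (x : E) : R := \big[Num.max/0]_(i < n) abs (coord e i x).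

Lemma coord_max_ge0 x : 0 <= coord_max x.
Proof. exact: bigmax_ge_id. Qed.

Lemma le_coord_max x i : abs (coord e i x) <= coord_max x.
Proof. exact: (le_bigmax _ (fun i => abs (coord e i x))). Qed.

Lemma coord_max_le x (c : R) :
  0 <= c -> (forall i, abs (coord e i x) <= c) -> coord_max x <= c.
Proof. by move=> c0 xc; apply: bigmax_le. Qed.

Hypothesis basis_e : basis_of {:E} e.

Lemma coord_max_norm : is_norm abs coord_max.
Proof.
case: (absK) => abs_ge0 abs0 absM absD; split=> [|x|c x|x y].
- exact: coord_max_ge0.
- split=> [x0|->]; last first.
    apply/eqP; rewrite eq_le coord_max_ge0 andbT coord_max_le// => i.
    by rewrite linear0 absolute_value0.
  rewrite (coord_basis basis_e (memvf x)) big1 // => i _.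
  suff /abs0 -> : abs (coord e i x) = 0 by rewrite scale0r.
  by apply/eqP; rewrite eq_le abs_ge0 andbT -x0 le_coord_max.
- rewrite /coord_max.
  under eq_bigr do rewrite linearZ /= absM.
  (* the default value 0 of the maximum is fixed by scaling *)
  elim/big_rec2: _ => [|i a b _ ->]; first by rewrite mulr0.
  by rewrite maxr_pMr.
- apply: coord_max_le => [|i]; first by rewrite addr_ge0 ?coord_max_ge0.
  by rewrite linearD /= (le_trans (absD _ _)) ?lerD ?le_coord_max.
Qed.

(** Each coordinate is dominated by the maximum, which gives the limits
    coordinate by coordinate; conversely, finitely many small coordinates make
    a small maximum, so the vector with these coordinates is the limit. *)
Lemma coord_max_complete : complete_for abs -> complete_for coord_max.
Proof.
move=> complK u cauchy_u.
have coord_cvg i : exists l,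
    (fun p => abs (coord e i (u p) - l)) @ \oo --> (0 : R).
  apply: complK => eps /cauchy_u[M uM]; exists M => p q Mp Mq.
  by rewrite -linearB /= (le_lt_trans (le_coord_max _ i)) ?uM.
have [l ul] := choice coord_cvg.
exists (\sum_i l i *: tnth e i).
have coord_l i : coord e i (\sum_j l j *: tnth e j) = l i.
  under eq_bigr do rewrite (tnth_nth 0).
  by rewrite coord_sum_free // (basis_free basis_e).
apply/cvgr0Pnorm_lt => eps eps0.
(* a finite intersection of neighborhoods of infinity, one per coordinate *)
have near_l : \forall p \near \oo, forall i : 'I_n,
    `|abs (coord e i (u p) - l i)| < eps.
  apply: filter_forall => i.
  by move/cvgr0Pnorm_lt: (ul i); apply.
near=> p.
rewrite ger0_norm ?coord_max_ge0 //; apply: bigmax_lt => // i _.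
rewrite linearB /= coord_l (le_lt_trans (ler_norm _)) //.
by move: i; near: p.
Unshelve. all: by end_near.
Qed.

End CoordMax.

Section Gamma.
Context (R : realType) (K : fieldType) (abs : K -> R) (n : nat).
Context (A : 'M[K]_n).

Lemma column_sum_le_gamma j : \sum_(i < n) abs (A i j) <= evo_gamma abs A.
Proof.
apply: ub_le_sup; last by exists j.
exists (\big[Num.max/0]_j \sum_(i < n) abs (A i j)) => _ [k _ <-].
exact: (le_bigmax _ (fun k => \sum_(i < n) abs (A i k))).
Qed.

Hypothesis absK : is_absolute_value abs.

Lemma evo_gamma_ge0 : 0 <= evo_gamma abs A.
Proof.
case: absK => abs_ge0 _ _ _.
case: (pickP [pred j : 'I_n | true]) => [j _|no_col].
  by rewrite (le_trans _ (column_sum_le_gamma j)) ?sumr_ge0.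
(* in dimension 0 the supremum of the empty set is 0 by convention *)
rewrite /evo_gamma (_ : [set _ | _ in _] = set0) ?sup0 // -subset0.
by move=> r [j]; have := no_col j.
Qed.

Lemma evo_gamma_gt0 : A != 0 -> 0 < evo_gamma abs A.
Proof.
case: absK => abs_ge0 abs0 _ _ A_neq0.
have [i [j Aij]] : exists i j, A i j != 0.
  apply: contrapT => noA; move/eqP: A_neq0; apply; apply/matrixP => i j.
  rewrite mxE; apply: contrapT => /eqP Aij.
  by apply: noA; exists i, j.
apply: lt_le_trans (column_sum_le_gamma j).
rewrite (bigD1 i) //= ltr_pwDl ?sumr_ge0 // lt_def abs_ge0 andbT.
by apply: contraNneq Aij => /abs0/eqP.
Qed.

Context (E : vectType K) (mul : {bilinear E -> E -> E}) (e : n.-tuple E).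
Hypothesis evoE : is_evolution_algebra mul e A.

(** Distinct basis vectors annihilate each other, so that only the diagonal
    terms of the double sum given by bilinearity remain. *)
Lemma coord_evolution_mul (a b : E) k :
  coord e k (mul a b) = \sum_i coord e i a * coord e i b * A i k.
Proof.
case: evoE => basis_e mul_neq mul_eq.
have expand x : x = \sum_i coord e i x *: tnth e i.
  rewrite {1}(coord_basis basis_e (memvf x)).
  by apply: eq_bigr => i _; rewrite (tnth_nth 0).
have coord_e i : coord e k (tnth e i) = (i == k)%:R.
  by rewrite (tnth_nth 0) coord_free ?(basis_free basis_e).
rewrite {1}(expand a) linear_sumlz linear_sum; apply: eq_bigr => i _ /=.
rewrite linearZl_LR /= {1}(expand b) linear_sumr /= (bigD1 i) //= big1 => [|j ji].
  rewrite addr0 linearZr_LR /= mul_eq !linearZ /= linear_sum /= mulrA.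
  congr (_ * _); rewrite (bigD1 k) //= big1 => [|j jk].
    by rewrite addr0 linearZ /= coord_e eqxx mulr1.
  by rewrite linearZ /= coord_e (negPf jk) mulr0.
by rewrite linearZr_LR /= mul_neq 1?eq_sym // scaler0.
Qed.

(** The index i of the sum in [coord_evolution_mul] runs along the k-th column
    of [A]; this is why column sums, and not row sums, bound the product. *)
Lemma coord_max_mul (a b : E) :
  coord_max abs e (mul a b) <=
  evo_gamma abs A * (coord_max abs e a * coord_max abs e b).
Proof.
case: (absK) => abs_ge0 _ absM _.
have max_ge0 : 0 <= coord_max abs e a * coord_max abs e b.
  by rewrite mulr_ge0 ?coord_max_ge0.
have bound k : abs (coord e k (mul a b)) <=
    evo_gamma abs A * (coord_max abs e a * coord_max abs e b).
  apply: le_trans (ler_wpM2r max_ge0 (column_sum_le_gamma k)).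
  rewrite coord_evolution_mul (le_trans (absolute_value_sum _ _)) //.
  rewrite mulr_suml ler_sum // => i _; rewrite !absM mulrC.
  by rewrite ler_wpM2l ?ler_pM ?le_coord_max.
by apply: coord_max_le => //; rewrite mulr_ge0 ?evo_gamma_ge0.
Qed.

End Gamma.

Theorem theorem4p1 (R : realType) (K : fieldType) (abs : K -> R) (n : nat)
    (E : vectType K) (mul : {bilinear E -> E -> E}) (e : n.-tuple E)
    (A : 'M[K]_n)
    (charK : [pchar K] =i pred0)
    (absK : is_absolute_value abs)
    (complK : complete_for abs)
    (evoE : is_evolution_algebra mul e A)
    (A_neq0 : A != 0) :
  is_banach_algebra abs mul (gamma_norm abs e A).
Proof.
have gamma_gt0 := evo_gamma_gt0 absK A_neq0.
have [basis_e _ _] := evoE.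
split; first split.
- exact: is_norm_scaled gamma_gt0 (coord_max_norm absK basis_e).
- move=> a b; rewrite /gamma_norm -mulrA ler_pM2l // mulrCA.
  exact: coord_max_mul.
- exact: complete_for_scaled gamma_gt0 (coord_max_complete basis_e complK).
Qed.
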